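(* For any input size $N$, input range $M=N^{O(1)}$, and fixed-precision bit complexity $p=O(\log M)$, there exists a transformer $f\in\mathcal{T}^{1,1}_{1,m,1,p}$ with a single self-attention unit with embedding dimension $m=3$ such that $f(X)=\mathrm{Match2}(X)$ for all $X\in[M]^N$ (where $f$ may use a positional encoding and a single appended blank token, as specified in the context).
   Context: $[M]=\{1,\dots,M\}$. For $X=(x_1,\dots,x_N)\in[M]^N$, $\mathrm{Match2}(X)\in\{0,1\}^N$ is defined by $\mathrm{Match2}(X)_i=1$ if there exists $j\in[N]$ with $x_i+x_j\equiv0\pmod M$, and $0$ otherwise. Self-attention. The row-wise softmax is $\mathrm{softmax}(A)_{i,j}=\exp(A_{i,j})/\sum_{j'}\exp(A_{i,j'})$. For $Q,K\in\mathbb{R}^{d\times m}$, $V\in\mathbb{R}^{d\times d'}$ encoded using $p$-bit fixed-point numbers, a self-attention unit is $f_{Q,K,V}(X)=\mathrm{softmax}(XQK^{\mathsf T}X^{\mathsf T})XV$, a map $\mathbb{R}^{N\times d}\to\mathbb{R}^{N\times d'}$ (defined for every sequence length). $\mathcal{A}_{d,m,d',p}$ is the set of all such units. MLP layer. $\Phi_{d,d',p}$ is the set of all (arbitrary) functions $\phi:\mathbb{R}^d\to\mathbb{R}^{d'}$ whose real-valued inputs and outputs can be represented using $p$-bit fixed-precision numbers, applied row-wise. Transformer with one layer and one head: $\mathcal{T}^{1,1}_{d,m,d',p}=\Phi_{m,d',p}\,\mathcal{A}_{m,m,m,p}\,\Phi_{d,m,p}$ (composition: input MLP, self-attention unit,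 output MLP). Conventions. Positional encoding: the index $i$ of an element may be encoded as an extra coordinate of the input, so the input MLP may depend on $i$ as well as on $x_i$. Blank token: the model may append a single constant token $x'$ to the sequence; $f$ represents a target $h$ on length-$N$ sequences if $f(X')_{1:N}=h(X)$ for $X'=(x_1,\dots,x_N,x')$.
   Formalization: The formal theorem also assumes log N ≤ M^a (i.e. log log N = O(log M)), as holds when M grows polynomially with N; without it, e.g. M = 5 fixed and N → ∞, p = O(log M) is constant and the claim fails. *)

(* Defs.v *)
From mathcomp Require Import all_boot all_order all_algebra.
From mathcomp Require Import reals.
From mathcomp Require Import sequences exp.

Set Implicit Arguments.
Unset Strict Implicit.
Unset Printing Implicit Defensive.

Import Order.TTheory GRing.Theory Num.Theory.

Local Open Scope ring_scope.

(* Entries are 0-indexed by 'I_N; the values range over [M] = {1, ..., M}. *)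
Definition Match2 (M N : nat) (X : 'I_N -> nat) (i : 'I_N) : bool :=
  [exists j : 'I_N, (X i + X j == 0 %[mod M])%N].

Section FixedPoint.
Variables (R : realType) (p s : nat).

(* p-bit fixed-point format with s fractional bits: k / 2^s, where k is a
   p-bit two's-complement integer. *)
Definition fixed_point (x : R) : Prop :=
  exists2 k : int, - (2 ^ p.-1)%:Z <= k < (2 ^ p.-1)%:Z & x = k%:~R / 2 ^+ s.

Definition fixed_point_mx m n (A : 'M[R]_(m, n)) : Prop :=
  forall i j, fixed_point (A i j).

(* Round to nearest, saturating at the ends of the representable range. *)
Definition fp_round (x : R) : R :=
  (Num.max (- (2 ^ p.-1)%:Z)
     (Num.min ((2 ^ p.-1)%:Z - 1) (Num.floor (x * 2 ^+ s + 2^-1))))%:~R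
  / 2 ^+ s.

(* An arbitrary function that reads its real arguments as p-bit numbers and
   whose values are p-bit numbers. *)
Definition Phi d d' (phi : 'rV[R]_d -> 'rV[R]_d') : Prop :=
  (forall x, phi x = phi (map_mx fp_round x)) /\
  (forall x, fixed_point_mx (phi x)).

End FixedPoint.

Section Transformer.
Variable R : realType.

Definition seq_map (d d' : nat) : Type :=
  forall n : nat, 'M[R]_(n, d) -> 'M[R]_(n, d').

Definition softmax m n (A : 'M[R]_(m, n)) : 'M[R]_(m, n) :=
  \matrix_(i, j) (expR (A i j) / \sum_(k < n) expR (A i k)).

Definition self_attention d m d' (Q K : 'M[R]_(d, m)) (V : 'M[R]_(d, d')) :
    seq_map d d' :=
  fun n X => softmax (X *m Q *m K^T *m X^T) *m X *m V.

Definition Attn (p s d m d' : nat) (g : seq_map d d') : Prop :=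
  exists (Q K : 'M[R]_(d, m)) (V : 'M[R]_(d, d')),
    [/\ fixed_point_mx p s Q, fixed_point_mx p s K, fixed_point_mx p s V
      & g = self_attention Q K V].

Definition rowwise d d' (phi : 'rV[R]_d -> 'rV[R]_d') : seq_map d d' :=
  fun n X => \matrix_(i < n) phi (row i X).

(* One layer, one head.  All p-bit numbers of a given transformer share one
   fixed-point format, whose number s of fractional bits is free. *)
Definition Transformer11 (p d m d' : nat) (f : seq_map d d') : Prop :=
  exists2 s : nat, (s <= p)%N &
  exists (phi : 'rV[R]_d -> 'rV[R]_m) (g : seq_map m m)
         (psi : 'rV[R]_m -> 'rV[R]_d'),
    [/\ Phi p s phi, Attn p s m g, Phi p s psi
      & f = fun n X => rowwise psi (g n (rowwise phi X))].

Definition append_blank N (X : 'I_N -> nat) (blank : R) : 'cV[R]_(N + 1) :=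
  col_mx (\col_(i < N) (X i)%:R) (const_mx blank).

(* Appends the (1-based) index of each row as an extra coordinate. *)
Definition pos_encode n d (X : 'M[R]_(n, d)) : 'M[R]_(n, d + 1) :=
  row_mx X (\col_(i < n) (i.+1)%:R).

End Transformer.

(* Main.v *)
(* Embed a nonzero residue k as the point v_k = (2, 2k, 2k^2) of a parabola: the
   polynomial -4(k + l - M)^2 is a bilinear form in v_k and v_l, vanishing on
   matches and at most -4 otherwise.  The null vector u = (0, 0, 1), used for the
   blank token, is paired with every v_k to -2, halfway between the two cases, so
   once the form is scaled by some c >= log N the softmax concentrates on the
   matches if there are any and on the blank token otherwise.  The residue 0 is
   sent to v_M = (-2, 0, 2M^2), which lies in the positive cone of the form (of
   signature (1,2)) and is negative against every v_k.  The first coordinate of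
   the attention output is then close to 2 or -2 if there is a match, and to 0 if
   there is none.  All weights are integers, so no fractional bits are needed. *)
Require Import Defs.
From mathcomp Require Import all_boot all_order all_algebra.
From mathcomp Require Import reals.
From mathcomp Require Import sequences exp.
From mathcomp Require Import zify ring lra.

Import Order.TTheory GRing.Theory Num.Theory.
Local Open Scope ring_scope.

(** * Fixed-point numbers and rounding *)

Lemma fixed_point_int (R : realType) (p : nat) (k : int) :
  - (2 ^ p.-1)%:Z <= k < (2 ^ p.-1)%:Z -> fixed_point p 0 (k%:~R : R).
Proof. by move=> hk; exists k => //; rewrite expr0 divr1. Qed.

Lemma fp_round_fixed_point (R : realType) (p s : nat) (x : R) :
  fixed_point p s (fp_round p s x).
Proof.
rewrite /fp_round; set k := Num.max _ _; exists k => //.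
have q0 : (0 < 2 ^ p.-1)%N by rewrite expn_gt0.
rewrite {}/k; move: (Num.floor _) (2 ^ p.-1)%N q0 => f q q0; lia.
Qed.

Lemma fp_round_id (R : realType) (p s : nat) (x : R) :
  fixed_point p s x -> fp_round p s x = x.
Proof.
case=> k /andP[lk ku] ->; rewrite /fp_round divfK ?expf_neq0 ?pnatr_eq0//.
have -> : Num.floor (k%:~R + 2^-1 : R) = k.
  apply: floor_def; rewrite intrD; apply/andP; split; lra.
congr (_%:~R / _); move: lk ku; lia.
Qed.

Lemma fp_round_idem (R : realType) (p s : nat) (x : R) :
  fp_round p s (fp_round p s x) = fp_round p s x.
Proof. exact/fp_round_id/fp_round_fixed_point. Qed.

(** Without fractional bits, rounding up at halves gives the half-open interval. [1 < p] puts 1 in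
    the representable range, so saturation cannot turn a positive value into 0. *)
Lemma fp_round_eq0 (R : realType) (p : nat) (x : R) : (1 < p)%N ->
  (fp_round p 0 x == 0) = (- 2^-1 <= x < 2^-1).
Proof.
move=> p1; rewrite /fp_round expr0 mulr1 divr1 intr_eq0.
have q1 : (1 < 2 ^ p.-1)%N by rewrite -{1}(expn0 2) ltn_exp2l//; lia.
have -> : (- 2^-1 <= x < 2^-1) = (Num.floor (x + 2^-1) == 0).
  apply/idP/idP => [h|/eqP h].
    by apply/eqP/floor_def; move/andP: h => [h1 h2]; apply/andP; split; lra.
  have /andP[] := floor_itv (x + 2^-1); rewrite h intrD => h1 h2.
  by apply/andP; split; lra.
move: (Num.floor _) (2 ^ p.-1)%N q1 => f q q1; lia.
Qed.

(** * Concentration of softmax averages *)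

(** The normalizer is at least [expR (s j0)], so each index with a value other than [t] has weight
    at most [expR (- g)]. Indices with value [t] contribute no error, however many share the
    mass. *)
Lemma softmax_concentration (R : realType) (n : nat) (s v : 'I_n -> R)
    (j0 : 'I_n) (t b g : R) :
  v j0 = t -> (forall j, `|v j - t| <= b) ->
  (forall j, v j = t \/ s j + g <= s j0) ->
  `|\sum_j expR (s j) / (\sum_k expR (s k)) * v j - t| <= b * n%:R * expR (- g).
Proof.
move=> vj0 vb hs; set Z := \sum_k expR (s k).
have Zge : expR (s j0) <= Z.
  by rewrite /Z (bigD1 j0)//= lerDl sumr_ge0// => j _; rewrite expR_ge0.
have Z0 : 0 < Z by apply: lt_le_trans Zge; exact: expR_gt0.
have -> : \sum_j expR (s j) / Z * v j - t =
          \sum_j expR (s j) / Z * (v j - t).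
  under [RHS]eq_bigr do rewrite mulrBr.
  by rewrite sumrB -!mulr_suml divff ?mul1r// gt_eqF.
have b0 : 0 <= b by apply: le_trans (vb j0).
apply: le_trans (ler_norm_sum _ _ _) _.
have -> : b * n%:R * expR (- g) = \sum_(j < n) (expR (- g) * b).
  by rewrite sumr_const card_ord -mulr_natr; ring.
apply: ler_sum => j _.
rewrite normrM ger0_norm ?divr_ge0 ?expR_ge0 ?(ltW Z0)//.
case: (hs j) => [->|sj]; first by rewrite subrr normr0 mulr0 mulr_ge0 ?expR_ge0.
apply: ler_pM => //; first by rewrite divr_ge0 ?expR_ge0 ?(ltW Z0).
rewrite ler_pdivrMr//; apply: le_trans (ler_wpM2l (expR_ge0 _) Zge).
by rewrite -expRD ler_expR; lra.
Qed.

Lemma exp2_le_expR (R : realType) (n : nat) : (2 ^ n)%:R <= expR (n%:R : R).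
Proof.
rewrite natrX -[n%:R]mulr1 expRM_natl lerXn2r ?nnegrE ?ler0n ?expR_ge0//.
by have := expR_ge1Dx (1 : R); lra.
Qed.

(** * The embedding and its bilinear form *)

Definition row3 {R : realType} (x y z : R) : 'rV[R]_3 :=
  \row_(j < 3) [:: x; y; z]`_j.

(* Codes all the residues; the argument M stands for the residue 0, and any
   argument outside {1, ..., M} (in particular 0) for the blank token. *)
Definition match_code (R : realType) (M k : nat) : 'rV[R]_3 :=
  if (0 < k < M)%N then row3 2 (2 * k%:R) (2 * k%:R ^+ 2)
  else if k == M then row3 (- 2) 0 (2 * M%:R ^+ 2)
  else row3 0 0 1.

(** Obtained by expanding -4(k + l - M)^2 and replacing 1, k, k^2 by half the coordinates of v_k,
    and likewise for l. *)
Definition match_query (R : realType) (M c : nat) : 'M[R]_3 :=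
  \matrix_(i < 3, j < 3)
    (c%:R * (nth [::] [:: [:: - M%:R ^+ 2; 2 * M%:R; -1];
                          [:: 2 * M%:R; - 2; 0];
                          [:: -1; 0; 0]] i)`_j).

Definition match_score (R : realType) (M c k l : nat) : R :=
  (match_code R M k *m match_query R M c *m (match_code R M l)^T) 0 0.

Lemma row3_score (R : realType) (M c : nat) (x y z x' y' z' : R) :
  (row3 x y z *m match_query R M c *m (row3 x' y' z')^T) 0 0 =
  c%:R * (2 * M%:R * (x * y' + y * x') - M%:R ^+ 2 * x * x'
          - 2 * y * y' - x * z' - z * x').
Proof.
rewrite !mxE !big_ord_recl big_ord0 !mxE !big_ord_recl !big_ord0 !mxE /=; ring.
Qed.

(** The sum lies between 2 and 2M, so it can only be M or 2M, and 2M forces both terms to be M. *)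
Lemma addn_modn_eq0 (M k l : nat) : (0 < k <= M)%N -> (0 < l <= M)%N ->
  (k + l == 0 %[mod M])%N = (k + l == M)%N || (k == M) && (l == M).
Proof.
move=> hk hl; rewrite mod0n -/(dvdn M (k + l)).
apply/dvdnP/idP => [[[|[|[|q]]] hq]|/orP[/eqP->|/andP[/eqP-> /eqP->]]].
- lia.
- lia.
- lia.
- nia.
- by exists 1%N; rewrite mul1n.
- by exists 2%N; rewrite mul2n addnn.
Qed.

Section Scores.
Variables (R : realType) (M c : nat).
Implicit Types k l : nat.

Lemma match_codeE k : (0 < k < M)%N ->
  match_code R M k = row3 2 (2 * k%:R) (2 * k%:R ^+ 2).
Proof. by rewrite /match_code => ->. Qed.

Lemma match_codeM : match_code R M M = row3 (- 2) 0 (2 * M%:R ^+ 2).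
Proof. by rewrite /match_code ltnn andbF eqxx. Qed.

Lemma match_code0 : (0 < M)%N -> match_code R M 0 = row3 0 0 1.
Proof. by case: M. Qed.

Lemma match_score_hit k l : (0 < k < M)%N -> (0 < l < M)%N -> (k + l = M)%N ->
  match_score R M c k l = 0.
Proof.
move=> hk hl kl; rewrite /match_score !match_codeE// row3_score -kl natrD; ring.
Qed.

Lemma match_score_miss k l : (0 < k < M)%N -> (0 < l < M)%N -> (k + l != M)%N ->
  match_score R M c k l <= c%:R * -4.
Proof.
move=> hk hl kl; rewrite /match_score !match_codeE// row3_score.
apply: ler_wpM2l; first exact: ler0n.
have : 1 <= (k%:R + l%:R - M%:R : R) ^+ 2.
  (* The difference may be negative, hence the passage through [int], where a nonzero square is at
     least 1. *)
  have -> : (k%:R + l%:R - M%:R : R) = (k%:Z + l%:Z - M%:Z)%:~R.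
    by rewrite !intrD intrN.
  rewrite -rmorphXn /= (_ : 1 = 1%:~R)// ler_int; nia.
nra.
Qed.

(** Both scores equal -4ck(2M - k), and k and 2M - k are at least 1. *)
Lemma match_score_residue0 k : (0 < k < M)%N ->
  match_score R M c k M <= c%:R * -4 /\ match_score R M c M k <= c%:R * -4.
Proof.
move=> hk; rewrite /match_score match_codeM !match_codeE// !row3_score.
have [k1 kM] : 1 <= k%:R :> R /\ k%:R + 1 <= M%:R :> R.
  by rewrite ler1n natr1 ler_nat; case/andP: hk.
split; (apply: ler_wpM2l; first exact: ler0n); nra.
Qed.

Lemma match_score_residue00 : match_score R M c M M = c%:R * (4 * M%:R ^+ 2).
Proof. by rewrite /match_score match_codeM row3_score; ring. Qed.

Lemma match_score_blank k : (0 < k < M)%N -> match_score R M c k 0 = c%:R * -2.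
Proof.
move=> hk; rewrite /match_score match_codeE// match_code0; last lia.
by rewrite row3_score; ring.
Qed.

(** The sign is opposite to that for the other queries, as v_M has first coordinate -2. The
    self-score 4cM^2 of the residue 0 still exceeds this by at least 2c. *)
Lemma match_score_residue0_blank : (0 < M)%N ->
  match_score R M c M 0 = c%:R * 2.
Proof.
by move=> hM; rewrite /match_score match_codeM match_code0// row3_score; ring.
Qed.

(** Provides the hypotheses of [softmax_concentration] with gap 2c. The guard [0 < Y j] keeps the
    blank from counting as a match of the residue 0. *)
Lemma match_target (n : nat) (Y : 'I_n -> nat) (i b : 'I_n) :
  Y b = 0%N -> (forall j, Y j <= M)%N -> (0 < Y i)%N ->
  exists (t : R) (j0 : 'I_n),
    [/\ match_code R M (Y j0) 0 0 = t,
      forall j, match_code R M (Y j) 0 0 = t \/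
        match_score R M c (Y i) (Y j) + c%:R * 2
          <= match_score R M c (Y i) (Y j0),
      t \in [:: 0; 2; -2]
    & (t == 0) = ~~ [exists j, (0 < Y j)%N && (Y i + Y j == 0 %[mod M])%N]].
Proof.
move=> Yb YM Yi.
have c0 : 0 <= c%:R :> R by exact: ler0n.
have M0 : (0 < M)%N by apply: leq_trans Yi (YM i).
have M1 : 1 <= M%:R ^+ 2 :> R by rewrite -natrX ler1n expn_gt0 M0.
have two0 : ((2 : R) == 0) = false by rewrite pnatr_eq0.
have Ycase j : [\/ Y j = 0%N, Y j = M | 0 < Y j < M]%N.
  have := YM j; rewrite leq_eqVlt; case: (posnP (Y j)) => [->|h].
    by constructor 1.
  by case/orP => [/eqP ->|->]; [constructor 2|constructor 3].
(* The residue 0 always matches itself, so [i] serves as its own maximizer. *)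
have [iM|iM] := eqVneq (Y i) M.
  exists (- 2), i; split.
  - by rewrite iM match_codeM mxE.
  - move=> j; rewrite iM match_score_residue00.
    have [->|->|hj] := Ycase j.
    + by right; rewrite match_score_residue0_blank//; nra.
    + by left; rewrite match_codeM mxE.
    + by right; have [_ ?] := match_score_residue0 _ hj; nra.
  - by rewrite !inE eqxx !orbT.
  - rewrite oppr_eq0 two0; apply/esym/negbTE; rewrite negbK.
    by apply/existsP; exists i; rewrite Yi addn_modn_eq0 ?Yi ?YM// iM eqxx orbT.
have hi : (0 < Y i < M)%N by rewrite Yi ltn_neqAle iM YM.
have [/existsP[j1 /andP[j1_gt0 h1]]|/existsPn hn] :=
  boolP [exists j, (0 < Y j)%N && (Y i + Y j == 0 %[mod M])%N].
  move: h1; rewrite addn_modn_eq0 ?Yi ?YM ?j1_gt0// (negbTE iM) orbF => /eqP h1.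
  have hj1 : (0 < Y j1 < M)%N by lia.
  exists 2, j1; split.
  - by rewrite match_codeE// mxE.
  - move=> j; rewrite (match_score_hit _ _ hi hj1 h1).
    have [->|->|hj] := Ycase j.
    + by right; rewrite match_score_blank//; nra.
    + by right; have [? _] := match_score_residue0 _ hi; nra.
    + by left; rewrite match_codeE// mxE.
  - by rewrite !inE eqxx !orbT.
  - by rewrite two0.
(* No match: the blank scores -2c and every other token at most -4c. *)
exists 0, b; split.
- by rewrite Yb match_code0// mxE.
- move=> j; rewrite Yb match_score_blank//.
  have [->|->|hj] := Ycase j.
  + by left; rewrite match_code0// mxE.
  + by right; have [? _] := match_score_residue0 _ hi; nra.
  + right; have kl : (Y i + Y j != M)%N.
      apply: contra (hn j) => kl; case/andP: (hj) => -> _.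
      by rewrite addn_modn_eq0 ?Yi ?YM ?kl//; lia.
    by have := match_score_miss _ _ hi hj kl; nra.
- by rewrite !inE eqxx.
- by rewrite eqxx.
Qed.

(** * Representability of codes and weights *)

Lemma match_code_fixed_point (p k : nat) : (0 < M)%N ->
  (2 * M ^ 2 < 2 ^ p.-1)%N -> fixed_point_mx p 0 (match_code R M k).
Proof.
move=> M0 hp i j; have M2 : (M <= M ^ 2)%N by rewrite leq_pmulr.
have fp (z : int) : (`|z| <= 2 * M ^ 2)%N -> fixed_point p 0 (z%:~R : R).
  by move=> hz; apply: fixed_point_int; lia.
have fpn (z : nat) : (z <= 2 * M ^ 2)%N -> fixed_point p 0 (z%:R : R).
  by move=> hz; rewrite pmulrn; apply: fp.
rewrite /match_code; case: ifPn => [/andP[k0 kM]|_]; last case: ifPn => _.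
- have k2 : (k ^ 2 <= M ^ 2)%N by rewrite leq_exp2r// ltnW.
  rewrite mxE; case: j => [[|[|[|//]]] ?] /=; first (apply: fpn; lia).
    by rewrite -natrM; apply: fpn; lia.
  by rewrite -natrX -natrM; apply: fpn; lia.
- rewrite mxE; case: j => [[|[|[|//]]] ?] /=.
  + by rewrite (_ : -2 = (-2)%:~R)//; apply: fp; lia.
  + exact: (fpn 0%N).
  + by rewrite -natrX -natrM; apply: fpn.
- rewrite mxE; case: j => [[|[|[|//]]] ?] /=.
  + exact: (fpn 0%N).
  + exact: (fpn 0%N).
  + by apply: (fpn 1%N); lia.
Qed.

Lemma match_query_fixed_point (p : nat) : (0 < M)%N ->
  (2 * (c * M ^ 2) < 2 ^ p.-1)%N -> fixed_point_mx p 0 (match_query R M c).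
Proof.
move=> M0 hp i j; have M2 : (M <= M ^ 2)%N by rewrite leq_pmulr.
have fp (z : int) : (`|z| <= 2 * (c * M ^ 2))%N -> fixed_point p 0 (z%:~R : R).
  by move=> hz; apply: fixed_point_int; lia.
have fpn (z : nat) : (z <= 2 * (c * M ^ 2))%N -> fixed_point p 0 (z%:R : R).
  by move=> hz; rewrite pmulrn; apply: fp.
have fpN (z : nat) : (z <= 2 * (c * M ^ 2))%N -> fixed_point p 0 (- z%:R : R).
  by move=> hz; rewrite pmulrn -intrN; apply: fp; lia.
have cM : (c * M <= c * M ^ 2)%N by rewrite leq_mul.
have c1 : (c <= c * M)%N by rewrite leq_pmulr.
rewrite mxE.
case: i => [[|[|[|//]]] ?] /=; case: j => [[|[|[|//]]] ?] /=;
  rewrite ?mulrN ?mulr1 ?mulr0 -?natrX -?natrM;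
  by [exact: (fpn 0%N)|apply: fpN; lia|apply: fpn; lia].
Qed.

End Scores.

(** * Attention output and its readout *)

Lemma near_readout_eq0 (R : realType) (t x : R) :
  t \in [:: 0; 2; -2] -> `|x - t| < 2^-1 -> (- 2^-1 <= x < 2^-1) = (t == 0).
Proof.
have two0 : ((2 : R) == 0) = false by rewrite pnatr_eq0.
rewrite ltr_norml !inE => + /andP[].
case/or3P=> /eqP-> h1 h2; rewrite ?oppr_eq0 ?two0 ?eqxx.
- by apply/andP; split; lra.
- by apply/negbTE/negP => /andP[? ?]; lra.
- by apply/negbTE/negP => /andP[? ?]; lra.
Qed.

Lemma attention_row (R : realType) (d m d' n : nat) (Q K : 'M[R]_(d, m))
    (V : 'M[R]_(d, d')) (X : 'M[R]_(n, d)) (i : 'I_n) (j : 'I_d') :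
  self_attention Q K V X i j =
  \sum_k expR ((row i X *m Q *m K^T *m (row k X)^T) 0 0) /
         (\sum_l expR ((row i X *m Q *m K^T *m (row l X)^T) 0 0)) *
         (X *m V) k j.
Proof.
have score l : (X *m Q *m K^T *m X^T) i l =
               (row i X *m Q *m K^T *m (row l X)^T) 0 0.
  rewrite -!row_mul [LHS]mxE [RHS]mxE [RHS]mxE.
  by apply: eq_bigr => k _; rewrite !mxE.
rewrite /self_attention -mulmxA mxE; apply: eq_bigr => k _; rewrite mxE score.
by under eq_bigr do rewrite score.
Qed.


Theorem theorem6 (R : realType) (a : nat) :
  exists C : nat, forall N M p : nat,
    (0 < N)%N -> (0 < M)%N ->
    (M <= N ^ a)%N -> (trunc_log 2 N <= M ^ a)%N ->
    (C * (trunc_log 2 M).+1 <= p)%N ->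
    exists (f : seq_map R (1 + 1) 1) (blank : R),
      Transformer11 p 3 f /\
      forall X : 'I_N -> nat, (forall i, 0 < X i <= M)%N ->
      forall i : 'I_N,
        f (N + 1)%N (pos_encode (append_blank X blank)) (lshift 1 i) 0
        = (Match2 M X i)%:R.
Proof.
(* The weights are bounded by a multiple of M^(a+2), costing a + 2 times the bit length of M; the
   other 4 cover the factor 8 and the sign bit. *)
exists (a + 6)%N => N M p N0 M0 _ logN hp.
(* Large enough that 2^(2c) > 8(N + 1), by [logN], yet polynomial in M, so that the entries of
   [match_query] fit in O(log M) bits. *)
set c := (M ^ a + 2)%N.
have Ma0 : (0 < M ^ a)%N by rewrite expn_gt0 M0.
have bound : (8 * M ^ (a + 2) < 2 ^ p.-1)%N.
  have MB : (M < 2 ^ (trunc_log 2 M).+1)%N by apply: trunc_log_ltn.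
  apply: (@leq_trans (8 * (2 ^ (trunc_log 2 M).+1) ^ (a + 2))).
    by rewrite ltn_pmul2l// ltn_exp2r// addn2.
  rewrite -expnM (_ : 8 = 2 ^ 3)%N// -expnD leq_exp2l//.
  by move: hp; set l := trunc_log 2 M; nia.
have p1 : (1 < p)%N.
  by apply: leq_trans hp; rewrite (@leq_trans (a + 6)) ?leq_pmulr//; lia.
have MaM : (M ^ (a + 2) = M ^ a * M ^ 2)%N by rewrite expnD.
have M20 : (0 < M ^ 2)%N by rewrite expn_gt0 M0.
pose phi (y : 'rV[R]_(1 + 1)) : 'rV[R]_3 :=
  match_code R M `|Num.floor (fp_round p 0 (y 0%R 0%R))|%N.
pose psi (y : 'rV[R]_3) : 'rV[R]_1 :=
  const_mx (fp_round p 0 (y 0 0) != 0)%:R.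
(* The whole form sits in the query matrix; keys and values are the codes themselves. *)
pose g := self_attention (match_query R M c) 1%:M (1%:M : 'M[R]_3).
have fp01 (z : bool) : fixed_point p 0 (z%:R : R).
  have : (1 < 2 ^ p.-1)%N by rewrite -{1}(expn0 2) ltn_exp2l//; lia.
  by move=> h; rewrite pmulrn; apply: fixed_point_int; case: z; lia.
exists (fun n X => rowwise psi (g n (rowwise phi X))), 0; split.
  exists 0%N => //; exists phi, g, psi; split => //.
  - split=> [y|y]; first by rewrite /phi mxE fp_round_idem.
    by apply: match_code_fixed_point => //; nia.
  - exists (match_query R M c), 1%:M, 1%:M; split => //.
    + by apply: match_query_fixed_point => //; rewrite /c; nia.
    + by move=> i j; rewrite mxE; exact: fp01.
    + by move=> i j; rewrite mxE; exact: fp01.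
  - split=> [y|y i j]; first by rewrite /psi mxE fp_round_idem.
    by rewrite mxE; exact: fp01.
move=> X hX i.
(* The blank token is 0, which no element of [M] equals. *)
pose Y (j : 'I_(N + 1)) := if split j is inl j' then X j' else 0%N.
have YM j : (Y j <= M)%N.
  by rewrite /Y; case: split => // j'; case/andP: (hX j').
have Yl j : Y (lshift 1 j) = X j.
  rewrite /Y; case: split_ordP => k; first by move/lshift_inj->.
  by move/eqP; rewrite eq_lrshift.
have Yr j : Y (rshift N j) = 0%N.
  by rewrite /Y; case: split_ordP => // k /eqP; rewrite eq_rlshift.
have rowX j : row j (rowwise phi (pos_encode (append_blank X 0))) =
              match_code R M (Y j).
  rewrite rowK /phi; congr match_code.
  have -> : row j (pos_encode (append_blank X 0)) 0 0 = (Y j)%:R :> R.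
    rewrite /pos_encode row_row_mx.
    rewrite (_ : (0 : 'I_(1 + 1)) = lshift 1 0); last exact: val_inj.
    rewrite row_mxEl [LHS]mxE /append_blank; case: (split_ordP j) => k ->.
      by rewrite col_mxEu Yl mxE.
    by rewrite col_mxEd Yr mxE.
  rewrite pmulrn fp_round_id ?intrKfloor//.
  by apply: fixed_point_int; have := YM j; nia.
have Yi : (0 < Y (lshift 1 i))%N by rewrite Yl; case/andP: (hX i).
have [t [j0 [tj0 ht tin t0]]] := match_target R M c _ Y _ _ (Yr 0) YM Yi.
have -> : Match2 M X i = (t != 0).
  rewrite t0 negbK; apply/existsP/existsP => -[j hj].
    by exists (lshift 1 j); rewrite !Yl hj andbT; case/andP: (hX j).
  move: hj; case: (split_ordP j) => k ->; rewrite ?Yr// !Yl.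
  by case/andP=> _ hk; exists k.
set out := g _ (rowwise phi _).
have outE : out (lshift 1 i) 0 =
    \sum_k expR (match_score R M c (Y (lshift 1 i)) (Y k)) /
      (\sum_l expR (match_score R M c (Y (lshift 1 i)) (Y l))) *
      match_code R M (Y k) 0 0.
  rewrite /out /g attention_row trmx1 !mulmx1.
  under eq_bigr => k _ do
    (under eq_bigr => l _ do rewrite !rowX; rewrite !rowX).
  by apply: eq_bigr => k _; rewrite -[in RHS](rowX k) [in RHS]mxE.
(* 4 is the largest distance between two of the readout values 0, 2, -2, and 1/2 is the rounding
   threshold of [psi]. *)
have small : 4 * (N + 1)%:R * expR (- (c%:R * 2)) < 2^-1 :> R.
  have NE : (8 * (N + 1))%:R < expR (c%:R * 2 : R).
    have := exp2_le_expR R (c * 2); rewrite natrM; apply: lt_le_trans.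
    rewrite ltr_nat.
    have NL : (N < 2 ^ (trunc_log 2 N).+1)%N by apply: trunc_log_ltn.
    apply: (@leq_ltn_trans (2 ^ (3 + (trunc_log 2 N).+1))).
      by rewrite expnD leq_mul2l addn1.
    by rewrite ltn_exp2l// /c; lia.
  rewrite expRN ltr_pdivrMr ?expR_gt0//; move: NE; rewrite natrM; lra.
have dist : `|out (lshift 1 i) 0 - t| < 2^-1.
  rewrite outE; apply: le_lt_trans small.
  apply: (softmax_concentration _ _ _ _ j0) => // j.
  have : match_code R M (Y j) 0 0 \in [:: 0; 2; -2].
    by rewrite /match_code; case: ifP => _; [|case: ifP => _];
      rewrite mxE !inE eqxx ?orbT.
  move: tin; rewrite !inE ler_norml.
  by move=> /or3P[] /eqP-> /or3P[] /eqP->; apply/andP; split; lra.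
rewrite /rowwise 2!mxE mxE fp_round_eq0//; congr (~~ _)%:R.
exact: near_readout_eq0 dist.
Qed.
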